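(* If $H$ is a $k$-regular bipartite graph with bipartition $|X|=|Y|=n$, where $n=ak+b$ for some integers $0\le a,b$ with $b<k$, that is partitioned into $b$ connected components of size $k+1$ and $a-b$ connected components of size $k$, then $$\lim_{k\rightarrow\infty}\frac{\mathcal{M}(H)}{(k!)^{n/k}}=1.$$
   Context: Graphs are simple. A graph is $k$-regular if every vertex is incident to exactly $k$ edges. A bipartite graph with bipartition $X,Y$ has vertex set $X\cup Y$ (disjoint) and every edge joins a vertex of $X$ to a vertex of $Y$. A connected component has size $s$ if it has $s$ vertices in $X$ and $s$ vertices in $Y$; thus a component of size $k$ is the complete bipartite graph $K_{k,k}$, and a component of size $k+1$ is a connected $k$-regular bipartite graph with $k+1$ vertices on each side. A perfect matching of $H$ is a set of $n$ edges such that every vertex is incident to exactly one of them, and $\mathcal{M}(H)$ denotes the number of perfect matchings of $H$. *)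

(* Defs.v *)
From HB Require Import structures.
From mathcomp Require Import all_boot all_order all_algebra.
From mathcomp Require Import all_classical all_reals all_analysis.

Set Implicit Arguments.
Unset Strict Implicit.
Unset Printing Implicit Defensive.

Record sgraph := SGraph {
  vertex :> finType;
  adj : rel vertex;
  adj_sym : symmetric adj;
  adj_irrefl : irreflexive adj }.

Definition edges (G : sgraph) : {set {set G}} :=
  [set [set p.1; p.2] | p : G * G & adj p.1 p.2]%SET.

Definition regular (G : sgraph) (k : nat) : Prop :=
  forall v : G, #|[set e in edges G | v \in e]%SET| = k.

Definition bipartition (G : sgraph) (X Y : {set G}) : Prop :=
  [/\ X :|: Y = [set: G]%SET,
      [disjoint X & Y]
    & forall u v : G, adj u v ->
        (u \in X /\ v \in Y) \/ (u \in Y /\ v \in X)].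

Definition components (G : sgraph) : {set {set G}} :=
  equivalence_partition (connect (@adj G)) [set: G]%SET.

Definition has_size (G : sgraph) (X Y C : {set G}) (s : nat) : bool :=
  (#|C :&: X| == s) && (#|C :&: Y| == s).

Definition components_of_size (G : sgraph) (X Y : {set G}) (s : nat) :
    {set {set G}} :=
  [set C in components G | has_size X Y C s]%SET.

Definition perfect_matching (G : sgraph) (n : nat) (M : {set {set G}}) : bool :=
  [&& M \subset edges G, #|M| == n
    & [forall v : G, #|[set e in M | v \in e]%SET| == 1]].

Definition num_perfect_matchings (G : sgraph) (n : nat) : nat :=
  #|[set M : {set {set G}} | perfect_matching n M]%SET|.

(* Main.v *)
(** A component of size [k] is [K_{k,k}], with [k!] perfect matchings. In a
    component of size [k + 1] every vertex misses exactly one vertex of the other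
    side, so it is [K_{k+1,k+1}] minus a perfect matching and its perfect
    matchings correspond to the derangements of [k + 1] points. Hence [M(H)] is
    [D_{k+1}^b (k!)^(a-b)], and dividing by [(k!)^(a + b/k)] leaves the [b]-th
    power of [D_{k+1}/(k+1)! * (k+1)/(k!)^(1/k)]. By inclusion-exclusion the
    first factor is a partial sum of the series of [exp (-1)]. The logarithm of
    the second one is the arithmetic mean of [j ln ((j+1)/j)] for
    [1 <= j <= k], which tends to [1] by Cesaro's lemma; so the second factor
    tends to [exp 1]. *)

Require Import Defs.
From HB Require Import structures.
From mathcomp Require Import all_boot all_order all_algebra.
From mathcomp Require Import all_classical all_reals all_analysis.
Import Order.TTheory GRing.Theory Num.Theory.
Import numFieldNormedType.Exports.
(* [finset] is required again because [classical_sets] shadows its lemma names. *)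
From mathcomp Require Import fintype finset fingroup perm ring.

Set Implicit Arguments.
Unset Strict Implicit.
Unset Printing Implicit Defensive.

Local Open Scope nat_scope.
Local Open Scope set_scope.

(** * Matchings that saturate a vertex set *)

(** Perfect matchings of the subgraph induced on [S], kept as sets of edges of [G] so that matchings
    of different components can be united and intersected directly. *)
Definition saturating_matchings (G : sgraph) (S : {set G}) :
    {set {set {set G}}} :=
  [set M : {set {set G}} | [forall e in M, (e \in edges G) && (e \subset S)] &&
    [forall v in S, #|[set e in M | v \in e]| == 1]].

Lemma saturating_matchingsP (G : sgraph) (S : {set G}) (M : {set {set G}}) :
  reflect [/\ {in M, forall e : {set G}, e \in edges G},
              {in M, forall e : {set G}, e \subset S}
            & {in S, forall v, exists2 e, e \in M /\ v \in e
                & {in M, forall e' : {set G}, v \in e' -> e' = e}}]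
          (M \in saturating_matchings S).
Proof.
rewrite inE; apply: (iffP andP) => [[/forall_inP hM /forall_inP hS]|[hE hS hv]].
  split=> [e /hM/andP[] //|e /hM/andP[] //|v /hS/cards1P[e he]].
  have /setP hse := he; exists e.
    by apply/andP; have := hse e; rewrite !inE eqxx.
  by move=> e' e'M ve'; have := hse e'; rewrite !inE e'M ve' => /esym/eqP.
split; first by apply/forall_inP=> e eM; rewrite hE // hS.
apply/forall_inP=> v /hv[e [eM ve] huniq].
apply/cards1P; exists e; apply/setP=> e'; rewrite !inE.
by apply/andP/eqP=> [[/huniq h /h]|->].
Qed.

Lemma edgesP (G : sgraph) (e : {set G}) :
  reflect (exists u v, adj u v /\ e = [set u; v]) (e \in edges G).
Proof.
apply: (iffP imsetP) => [[[u v]]|].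
  by rewrite inE => huv ->; exists u, v.
by case=> u [v [huv ->]]; exists (u, v); rewrite ?inE.
Qed.

Lemma edge_incidentP (G : sgraph) (e : {set G}) (v : G) :
  e \in edges G -> v \in e -> exists2 u, adj v u & e = [set v; u].
Proof.
case/edgesP=> u [w [huw ->]]; rewrite !inE => /orP[]/eqP->; first by exists w.
by exists u; rewrite 1?adj_sym // setUC.
Qed.

Lemma set2_injr (T : finType) (x y z : T) : [set x; y] = [set x; z] -> y = z.
Proof.
move/setP=> h; have := h y; have := h z; rewrite !inE !eqxx !orbT.
by case: (eqVneq y x) => [->|_] /=; [case: (eqVneq z x)|move=> _ /esym/eqP].
Qed.

(** Regularity counts incident edges, whereas the structure of components is read off from
    neighbourhoods; [u] corresponds to the edge [[set v; u]]. *)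
Lemma card_incident_edges (G : sgraph) (v : G) :
  #|[set e in edges G | v \in e]| = #|[set u | adj v u]|.
Proof.
rewrite -(@card_in_imset _ _ (fun u => [set v; u]) [set u | adj v u]).
  apply: eq_card => e; rewrite !inE; apply/andP/imsetP.
    by case=> eE /(edge_incidentP eE)[u vu ->]; exists u; rewrite ?inE.
  case=> u; rewrite inE => vu ->; rewrite !inE eqxx; split=> //.
  by apply/edgesP; exists v, u.
by move=> u w _ _; apply: set2_injr.
Qed.

(** * Multiplicativity over closed vertex sets *)

Definition adj_closed (G : sgraph) (S : {set G}) :=
  forall u v : G, adj u v -> u \in S -> v \in S.

Lemma adj_closed_edge (G : sgraph) (S : {set G}) e (v : G) :
  adj_closed S -> e \in edges G -> v \in e -> v \in S -> e \subset S.
Proof.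
move=> hS eE ve vS; have [u vu ->] := edge_incidentP eE ve.
by rewrite subUset !sub1set vS (hS _ _ vu vS).
Qed.

Lemma edge_neq0 (G : sgraph) (e : {set G}) : e \in edges G -> exists v, v \in e.
Proof. by case/edgesP=> u [v [_ ->]]; exists u; rewrite !inE eqxx. Qed.

(** No edge leaves a closed set, so a matching of the union is the same as an independent pair of
    matchings, one on each side. *)
Lemma card_saturating_matchingsU (G : sgraph) (S T : {set G}) :
  adj_closed S -> adj_closed T -> [disjoint S & T] ->
  #|saturating_matchings (S :|: T)| =
    #|saturating_matchings S| * #|saturating_matchings T|.
Proof.
move=> hS hT dST.
have nST v : v \in S -> v \notin T by move/(disjointFr dST)->.
(* The bijection restricts [M] to the edges inside [S] and to those inside [T]; its inverse is the
   union. *)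
pose f (M : {set {set G}}) := (M :&: powerset S, M :&: powerset T).
rewrite -cardsX -(@card_in_imset _ _ f (saturating_matchings (S :|: T))).
  apply: eq_card => -[M N]; rewrite in_setX /=.
  apply/imsetP/andP=> [[K /saturating_matchingsP[KE KS Kv] [-> ->]]|].
    split; apply/saturating_matchingsP; split.
    - by move=> e /setIP[/KE].
    - by move=> e /setIP[_]; rewrite powersetE.
    - move=> v vS; have [|e [eK ve] huniq] := Kv v; first by rewrite inE vS.
      exists e; last by move=> e' /setIP[/huniq].
      by rewrite inE powersetE eK (adj_closed_edge hS (KE _ eK) ve vS).
    - by move=> e /setIP[/KE].
    - by move=> e /setIP[_]; rewrite powersetE.
    - move=> v vT; have [|e [eK ve] huniq] := Kv v; first by rewrite inE vT orbT.
      exists e; last by move=> e' /setIP[/huniq].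
      by rewrite inE powersetE eK (adj_closed_edge hT (KE _ eK) ve vT).
  case=> /saturating_matchingsP[ME MS Mv] /saturating_matchingsP[NE NT Nv].
  exists (M :|: N).
    apply/saturating_matchingsP; split.
    - by move=> e /setUP[/ME|/NE].
    - move=> e /setUP[/MS|/NT] h.
        exact: subset_trans h (subsetUl _ _).
      exact: subset_trans h (subsetUr _ _).
    - move=> v /setUP[vS|vT].
        have [e [eM ve] huniq] := Mv v vS.
        exists e; first by rewrite inE eM.
        move=> e' /setUP[/huniq //|/NT/subsetP h /h vT].
        by move: (nST v vS); rewrite vT.
      have [e [eN ve] huniq] := Nv v vT.
      exists e; first by rewrite inE eN orbT.
      move=> e' /setUP[/MS/subsetP h /h vS|/huniq //].
      by move: (nST v vS); rewrite vT.
  (* Restricting [M :|: N] gives back [M] and [N]: an edge is nonempty, so it cannot lie inside both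
     of the disjoint sets. *)
  congr pair; apply/setP=> e; rewrite !inE.
    case: (boolP (e \in M)) => [eM|neM] /=; first by rewrite MS.
    apply/esym/negbTE/andP=> -[eN /subsetP eS].
    have [v ve] := edge_neq0 (NE _ eN).
    by move: (nST v (eS v ve)); rewrite (subsetP (NT _ eN)).
  case: (boolP (e \in N)) => [eN|neN] /=; first by rewrite NT // orbT.
  rewrite orbF; apply/esym/negbTE/andP=> -[eM /subsetP eT].
  have [v ve] := edge_neq0 (ME _ eM).
  by move: (nST v (subsetP (MS _ eM) v ve)); rewrite eT.
(* Injectivity of [f]: each edge has a vertex in [S] or in [T], and closedness puts the whole edge
   there. *)
have split_ M : M \in saturating_matchings (S :|: T) ->
    M = (f M).1 :|: (f M).2.
  case/saturating_matchingsP=> ME MS _; apply/setP=> e; rewrite !inE.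
  case: (boolP (e \in M)) => //= eM; have [v ve] := edge_neq0 (ME _ eM).
  have := subsetP (MS _ eM) v ve; rewrite inE => /orP[]h.
    by rewrite (adj_closed_edge hS (ME _ eM) ve h).
  by rewrite (adj_closed_edge hT (ME _ eM) ve h) orbT.
by move=> M N /split_ eM /split_ eN efMN; rewrite eM eN efMN.
Qed.

Lemma card_saturating_matchings0 (G : sgraph) :
  #|saturating_matchings (set0 : {set G})| = 1.
Proof.
apply/eqP/cards1P; exists set0; apply/setP=> M; rewrite in_set1.
apply/saturating_matchingsP/eqP=> [[ME MS _]|->].
  apply/setP=> e; rewrite inE; apply/negP=> eM.
  have [v /(subsetP (MS _ eM))] := edge_neq0 (ME _ eM).
  by rewrite inE.
by split=> v; rewrite inE.
Qed.

Lemma card_saturating_matchings_cover (G : sgraph) (P : {set {set G}}) :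
  trivIset P -> {in P, forall C, adj_closed C} ->
  #|saturating_matchings (cover P)| = \prod_(C in P) #|saturating_matchings C|.
Proof.
have [m] := ubnP #|P|; elim: m P => // m IH P hm tP hP.
have [->|[C CP]] := set_0Vmem P.
  by rewrite /cover !big_set0 card_saturating_matchings0.
have tP' : trivIset (P :\ C) by apply: trivIsetS tP; rewrite subsetDl.
have hP' : {in P :\ C, forall D, adj_closed D} by move=> D /setD1P[_ /hP].
rewrite (big_setD1 C CP) /= -IH //; last by rewrite (cardsD1 C P) CP in hm.
have -> : cover P = C :|: cover (P :\ C).
  by rewrite /cover (big_setD1 C CP).
apply: card_saturating_matchingsU; first exact: hP.
  move=> u v uv /bigcupP[D DP uD]; apply/bigcupP; exists D => //.
  exact: (hP' D DP u v).
apply/bigcup_disjointP=> D /setD1P[DC DP].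
by move/trivIsetP: tP; apply; rewrite // eq_sym.
Qed.

(** * Matchings of a bipartite piece as permutations *)

(** With both sides enumerated by the same type, a matching is the graph of a permutation. The
    enumerations stay arbitrary so that they can later be chosen to suit the component. *)
Lemma card_permuted_matchings (G : sgraph) (T : finType) (S : {set G})
    (al be : T -> G) :
  injective al -> injective be -> (forall i j, al i != be j) ->
  (forall v, v \in S = (v \in codom al) || (v \in codom be)) ->
  (forall u v, adj u v -> u \in S -> v \in S ->
     (u \in codom al) = (v \in codom be)) ->
  #|saturating_matchings S| =
    #|[set s : {perm T} | [forall i, adj (al i) (be (s i))]]|.
Proof.
move=> ial ibe albe hS hadj.
pose M (s : {perm T}) := [set [set al i; be (s i)] | i : T].
have alS i : al i \in S by rewrite hS codom_f.
have beS i : be i \in S by rewrite hS codom_f orbT.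
have edge_eq i j i' j' :
    [set al i; be j] = [set al i'; be j'] -> i = i' /\ j = j'.
  move=> /setP h; have := h (al i); have := h (be j).
  rewrite !inE !eqxx orbT /= (negbTE (albe _ _)) orbF.
  rewrite [_ == al i']eq_sym (negbTE (albe _ _)) /=.
  by move=> /esym/eqP/ibe -> /esym/eqP/ial ->.
rewrite -(@card_in_imset _ _ M [set s : {perm T} | _]); last first.
  move=> s t _ _ /setP hst; apply/permP=> i.
  have : [set al i; be (s i)] \in M t.
    by rewrite -hst; apply/imsetP; exists i.
  by case/imsetP=> j _ /edge_eq[-> ->].
apply: eq_card => N; apply/saturating_matchingsP/imsetP.
  case=> NE NS Nv.
  (* The matching edge at [al i] stays inside [S], and its other end lies on the [be] side by
     [hadj]. *)
  have ex i : exists j, (adj (al i) (be j)) && ([set al i; be j] \in N).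
    have [e [eN ie] _] := Nv _ (alS i).
    have [u iu eu] := edge_incidentP (NE _ eN) ie.
    have uS : u \in S by apply: (subsetP (NS _ eN)); rewrite eu !inE eqxx orbT.
    have := hadj _ _ iu (alS i) uS; rewrite codom_f => /esym/codomP[j uj].
    by exists j; rewrite -uj -eu iu eN.
  pose s i := xchoose (ex i).
  have sP i : adj (al i) (be (s i)) /\ [set al i; be (s i)] \in N.
    exact/andP/(xchooseP (ex i)).
  (* Two indices with the same image would give two matching edges at one vertex of the [be]
     side. *)
  have is_ : injective s.
    move=> i j sij; have [e [eN ve] huniq] := Nv _ (beS (s i)).
    have hi := huniq _ (sP i).2; have hj := huniq _ (sP j).2.
    move: hi hj; rewrite -sij !inE !eqxx !orbT => /(_ isT) hi /(_ isT) hj.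
    by case: (edge_eq i (s i) j (s i)); rewrite // hi hj.
  exists (perm is_).
    by rewrite inE; apply/forallP=> i; rewrite permE (sP i).1.
  apply/setP=> e; apply/idP/imsetP=> [eN|[i _ ->]]; last first.
    by rewrite permE (sP i).2.
  (* Every edge of [N] has an end on the [al] side, so uniqueness at that end identifies it with an
     edge chosen by [s]. *)
  have [i ie] : exists i, al i \in e.
    case/edgesP: (NE _ eN) => u [v [uv euv]].
    have uS : u \in S by apply: (subsetP (NS _ eN)); rewrite euv !inE eqxx.
    have vS : v \in S.
      by apply: (subsetP (NS _ eN)); rewrite euv !inE eqxx orbT.
    have := uS; rewrite hS => /orP[/codomP[i ui]|ube].
      by exists i; rewrite euv -ui !inE eqxx.
    have := hadj v u; rewrite adj_sym ube => /(_ uv vS uS)/codomP[i vi].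
    by exists i; rewrite euv -vi !inE eqxx orbT.
  exists i => //; have [e' [eN' ve'] huniq] := Nv _ (alS i).
  rewrite (huniq e eN ie) permE; apply/esym/(huniq _ (sP i).2).
  by rewrite !inE eqxx.
case=> s; rewrite inE => /forallP hs ->; split.
- by move=> e /imsetP[i _ ->]; apply/edgesP; exists (al i), (be (s i)).
- by move=> e /imsetP[i _ ->]; rewrite subUset !sub1set alS beS.
- move=> v; rewrite hS => /orP[/codomP[i ->]|/codomP[j ->]].
    exists [set al i; be (s i)].
      by rewrite !inE eqxx; split=> //; apply: imset_f.
    move=> e /imsetP[j _ ->]; rewrite !inE (negbTE (albe _ _)) orbF.
    by move=> /eqP/ial->.
  exists [set al (s^-1 j)%g; be (s (s^-1 j)%g)].
    rewrite !inE permKV eqxx orbT; split=> //.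
    by apply/imsetP; exists (s^-1 j)%g; rewrite // permKV.
  move=> e /imsetP[i _ ->]; rewrite !inE eq_sym (negbTE (albe _ _)) /=.
  by move=> /eqP/ibe->; rewrite permK.
Qed.

(** * Counting derangements *)

Section Derangements.
Local Open Scope ring_scope.

Lemma card_derangements (R : numFieldType) (T : finType) :
  #|[set s : {perm T} | [forall i, s i != i]]|%:R =
    (#|T|)`!%:R * \sum_(j < #|T|.+1) (-1) ^+ j / j`!%:R :> R.
Proof.
(* The indicator of a derangement is the product over [i] of one minus the indicator of
   [s i = i]. *)
have -> : #|[set s : {perm T} | [forall i, s i != i]]|%:R =
    \sum_(s : {perm T}) \prod_i (- (s i == i)%:R + 1) :> R.
  rewrite -sum1_card natr_sum big_mkcond /=; apply: eq_bigr => s _.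
  rewrite inE; case: (boolP [forall i, _]) => [/forallP h|].
    by rewrite big1 // => i _; rewrite (negbTE (h i)) oppr0 add0r.
  rewrite negb_forall => /existsP[i /negPn hi].
  by rewrite (bigD1 i) //= hi addNr mul0r.
(* The term of [J] in the expanded product survives exactly when [s] fixes [J] pointwise, that is,
   moves only points of the complement. *)
have fixing (J : {set T}) (s : {perm T}) :
    \prod_i (if i \in J then - (s i == i)%:R else 1) =
    (-1) ^+ #|J| * (perm_on (~: J) s)%:R :> R.
  case: (boolP (perm_on _ s)) => [/fintype.subsetP h|].
    rewrite mulr1 -big_mkcond /= (eq_bigr (fun=> -1)) ?prodr_const //.
    move=> i iJ; case: eqP => // /eqP si.
    by have := h i si; rewrite inE iJ.
  case/subsetPn=> i; rewrite !inE negbK => si iJ.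
  by rewrite mulr0 (bigD1 i) //= iJ (negbTE si) oppr0 mul0r.
(* inclusion-exclusion: [J] is a set of points that [s] must fix *)
under eq_bigr => s _ do rewrite bigA_distr.
rewrite exchange_big /=.
under eq_bigr => J _ do under eq_bigr => s _ do rewrite fixing.
(* Terms are grouped by the size of [J]; as this is at most [#|T|], [inord] never falls back to its
   default. *)
rewrite (partition_big (fun J : {set T} => inord #|J| : 'I_#|T|.+1) predT) //=.
rewrite mulr_sumr; apply: eq_bigr => j _.
have jT : (j <= #|T|)%N by rewrite -ltnS.
rewrite (eq_bigr (fun=> (-1) ^+ j * (#|T| - j)`!%:R)); last first.
  move=> J /eqP hJ; have cJ : #|J| = j.
    by rewrite -hJ inordK // ltnS max_card.
  rewrite -mulr_sumr cJ; congr (_ * _); rewrite -cJ.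
  have -> : (#|T| - #|J| = #|~: J|)%N by rewrite (cardsCs (~: J)) setCK.
  rewrite -card_perm -sum1_card natr_sum [RHS]big_mkcond /=.
  apply: eq_bigr => s _; rewrite -[s \in _]/(perm_on (~: J) s).
  by case: (perm_on _ s).
rewrite (eq_bigl (mem [set J : {set T} | #|J| == j])); last first.
  move=> J; have cJ : (#|J| < #|T|.+1)%N by rewrite ltnS max_card.
  by rewrite -val_eqE /= inordK // inE.
rewrite sumr_const card_draws.
(* There are ['C(#|T|, j)] sets of size [j], each with [(#|T| - j)!] permutations; the product is
   [#|T|! / j!]. *)
rewrite -(bin_fact jT) !natrM -mulr_natl.
by field; rewrite pnatr_eq0 -lt0n fact_gt0.
Qed.
End Derangements.

(** * Components of a regular bipartite graph *)

Lemma ord_enumeration (T : finType) (A : {set T}) (m : nat) :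
  #|A| = m -> exists2 f : 'I_m -> T, injective f & codom f =i A.
Proof.
move=> hA; exists (fun i => enum_val (cast_ord (esym hA) i)).
  by move=> i j /enum_val_inj/cast_ord_inj.
move=> v; apply/codomP/idP=> [[i ->]|vA]; first exact: enum_valP.
exists (cast_ord hA (enum_rank_in vA v)).
by rewrite cast_ordK enum_rankK_in.
Qed.

Lemma bipartition_sym (G : sgraph) (X Y : {set G}) :
  bipartition X Y -> bipartition Y X.
Proof.
case=> hU hD hE; split; rewrite 1?setUC 1?disjoint_sym // => u v /hE[].
  by right.
by left.
Qed.

Lemma bipartition_adj (G : sgraph) (X Y : {set G}) (u v : G) :
  bipartition X Y -> adj u v -> (u \in X) = (v \in Y).
Proof.
case=> _ hD hE /hE[[-> ->] //|[uY vX]].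
by rewrite (disjointFl hD uY) (disjointFr hD vX).
Qed.

Lemma card_perfect_matching (G : sgraph) (X Y : {set G}) (M : {set {set G}}) :
  bipartition X Y -> M \in saturating_matchings [set: G] -> #|M| = #|X|.
Proof.
move=> hXY; rewrite inE => /andP[/forall_inP hM /forall_inP hv].
rewrite -!sum1_card.
(* Double counting of incidences: each edge has exactly one end in [X], and each vertex of [X] lies
   on exactly one edge of [M]. *)
transitivity (\sum_(e in M) \sum_(x in X) (x \in e)).
  apply: eq_bigr => e /hM/andP[eE _].
  have [x xX ex] : exists2 x, x \in X & x \in e.
    case/edgesP: eE => u [v [uv ->]].
    case: hXY => _ _ /(_ _ _ uv)[[uX _]|[_ vX]].
      by exists u; rewrite // !inE eqxx.
    by exists v; rewrite // !inE eqxx orbT.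
  have [y xy ey] := edge_incidentP eE ex.
  rewrite (bigD1 x) //= ex big1 // => z /andP[zX zx].
  have yY : y \in Y by rewrite -(bipartition_adj hXY xy).
  rewrite ey !inE (negbTE zx) /=; case: eqP => // zy.
  by case: hXY => _ /disjointFr/(_ zX); rewrite zy yY.
rewrite exchange_big /=; apply: eq_bigr => x _.
rewrite -[RHS](eqP (hv x (in_setT x))) -sum1_card.
rewrite big_mkcond [RHS]big_mkcond /=; apply: eq_bigr => e _.
by rewrite inE; case: (e \in M); case: (x \in e).
Qed.

Lemma num_perfect_matchingsE (G : sgraph) (X Y : {set G}) :
  bipartition X Y ->
  num_perfect_matchings G #|X| = #|saturating_matchings [set: G]|.
Proof.
move=> hXY; apply: eq_card => M; rewrite inE; apply/idP/idP.
  case/and3P=> /fintype.subsetP ME _ /forallP hv; rewrite inE; apply/andP; split.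
    by apply/forall_inP=> e /ME ->; rewrite subsetT.
  by apply/forall_inP=> v _; apply: hv.
move=> MS; have hM := card_perfect_matching hXY MS.
move: MS; rewrite inE => /andP[/forall_inP ME /forall_inP hv].
apply/and3P; split; first by apply/fintype.subsetP=> e /ME/andP[].
  exact/eqP.
by apply/forallP=> v; apply: hv.
Qed.

Lemma components_partition (G : sgraph) : partition (components G) [set: G].
Proof.
apply: equivalence_partitionP => u v w _ _ _; split; first exact: connect0.
by move=> uv; apply: same_connect => //; apply/sym_connect_sym/adj_sym.
Qed.

Lemma component_adj_closed (G : sgraph) (C : {set G}) :
  C \in components G -> adj_closed C.
Proof.
case/imsetP=> x _ -> u v uv; rewrite !inE /= => xu.
exact: connect_trans xu (connect1 uv).
Qed.

Lemma card_bipartite_matchings (G : sgraph) (X Y C : {set G}) (T : finType)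
    (al be : T -> G) :
  bipartition X Y -> injective al -> injective be ->
  codom al =i C :&: X -> codom be =i C :&: Y ->
  #|saturating_matchings C| =
    #|[set s : {perm T} | [forall i, adj (al i) (be (s i))]]|.
Proof.
move=> hXY ial ibe hal hbe; have [hU hD _] := hXY.
apply: card_permuted_matchings => //.
- move=> i j; apply/eqP=> ij; have := codom_f be j; have := codom_f al i.
  rewrite hal hbe !inE ij => /andP[_ jX] /andP[_ jY].
  by rewrite (disjointFr hD jX) in jY.
- by move=> v; rewrite hal hbe -in_setU -setIUr hU setIT.
- by move=> u v uv uC vC; rewrite hal hbe !inE uC vC (bipartition_adj hXY uv).
Qed.

Lemma card_neighbours (G : sgraph) (k : nat) (v : G) :
  regular G k -> #|[set u | adj v u]| = k.
Proof. by move=> hreg; rewrite -card_incident_edges hreg. Qed.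

Lemma neighbours_sub (G : sgraph) (X Y C : {set G}) (v : G) :
  bipartition X Y -> adj_closed C -> v \in C :&: X ->
  [set u | adj v u] \subset C :&: Y.
Proof.
move=> hXY hC /setIP[vC vX]; apply/fintype.subsetP=> u; rewrite !inE => vu.
by rewrite (hC _ _ vu vC) -(bipartition_adj hXY vu).
Qed.

(** The [k] neighbours of a vertex of [C :&: X] fill all of [C :&: Y], so every permutation is
    admissible. *)
Lemma card_matchings_complete (G : sgraph) (X Y C : {set G}) (k : nat) :
  regular G k -> bipartition X Y -> adj_closed C -> has_size X Y C k ->
  #|saturating_matchings C| = k`!.
Proof.
move=> hreg hXY hC /andP[/eqP cX /eqP cY].
have [al ial hal] := ord_enumeration cX.
have [be ibe hbe] := ord_enumeration cY.
rewrite (card_bipartite_matchings hXY ial ibe hal hbe) -card_Sn -cardsT.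
apply: eq_card => s; rewrite !inE; apply/forallP=> i.
have alX : al i \in C :&: X by rewrite -hal codom_f.
have beY : be (s i) \in C :&: Y by rewrite -hbe codom_f.
have /eqP hN : [set u | adj (al i) u] == C :&: Y.
  by rewrite eqEcard (neighbours_sub hXY hC alX) cY (card_neighbours _ hreg) /=.
by move: beY; rewrite -hN inE.
Qed.

Lemma single_nonneighbour (G : sgraph) (X Y C : {set G}) (k : nat) (v : G) :
  regular G k -> bipartition X Y -> adj_closed C -> has_size X Y C k.+1 ->
  v \in C :&: X ->
  exists w, (C :&: Y) :\: [set u | adj v u] = [set w].
Proof.
move=> hreg hXY hC /andP[_ /eqP cY] vX; apply/cards1P.
rewrite cardsD (setIidPr (neighbours_sub hXY hC vX)).
by rewrite cY (card_neighbours _ hreg) subSnn.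
Qed.

(** The [Y] side is enumerated by letting [be i] be the only vertex there not adjacent to [al i];
    then [al i] and [be (s i)] are adjacent exactly when [s i != i]. *)
Lemma card_matchings_crown (G : sgraph) (X Y C : {set G}) (k : nat) :
  regular G k -> bipartition X Y -> adj_closed C -> has_size X Y C k.+1 ->
  #|saturating_matchings C| =
    #|[set s : {perm 'I_k.+1} | [forall i, s i != i]]|.
Proof.
move=> hreg hXY hC hsz; have /andP[/eqP cX /eqP cY] := hsz.
have [al ial hal] := ord_enumeration cX.
have alX i : al i \in C :&: X by rewrite -hal codom_f.
have /fin_all_exists[be hbe] i := single_nonneighbour hreg hXY hC hsz (alX i).
have beP i : be i \in C :&: Y /\ ~~ adj (al i) (be i).
  by have := set11 (be i); rewrite -hbe in_setD inE => /andP[-> ->].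
(* By the same argument with the sides exchanged, [be i] also misses only one vertex of
   [C :&: X]. *)
have ibe : injective be.
  move=> i j ij.
  have hsz' : has_size Y X C k.+1 by rewrite /has_size andbC.
  have [w hw] :=
    single_nonneighbour hreg (bipartition_sym hXY) hC hsz' (beP i).1.
  have hi : al i \in [set w].
    by rewrite -hw inE alX andbT inE adj_sym (beP i).2.
  have hj : al j \in [set w].
    by rewrite -hw inE alX andbT inE adj_sym ij (beP j).2.
  by move: hi hj; rewrite !inE => /eqP <- /eqP/ial.
(* An injection of [k.+1] indices into a set of [k.+1] vertices is onto. *)
have cbe : codom be =i C :&: Y.
  apply/subset_cardP; first by rewrite card_codom // card_ord cY.
  by apply/fintype.subsetP=> _ /codomP[i ->]; case: (beP i).
rewrite (card_bipartite_matchings hXY ial ibe hal cbe).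
apply: eq_card => s; rewrite !inE; apply: eq_forallb => i.
have /setP/(_ (be (s i))) := hbe i.
rewrite in_setD (beP _).1 andbT !inE (inj_eq ibe) => <-.
by rewrite negbK.
Qed.

Lemma card_perfect_matchings_components (G : sgraph) (X Y : {set G})
    (a b k : nat) :
  regular G k -> bipartition X Y ->
  components G = components_of_size X Y k.+1 :|: components_of_size X Y k ->
  #|components_of_size X Y k.+1| = b ->
  #|components_of_size X Y k| = a - b ->
  num_perfect_matchings G #|X| =
    #|[set s : {perm 'I_k.+1} | [forall i, s i != i]]| ^ b * k`! ^ (a - b).
Proof.
move=> hreg hXY hcomp hb ha; rewrite (num_perfect_matchingsE hXY).
have /and3P[/eqP <- tC _] := components_partition G.
rewrite card_saturating_matchings_cover //; last exact: component_adj_closed.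
rewrite hcomp (big_setID (components_of_size X Y k.+1)) /= setUK setDUl setDv.
rewrite set0U.
(* A component cannot have both sizes, so the product over components splits into two separate
   products. *)
have -> : components_of_size X Y k :\: components_of_size X Y k.+1 =
    components_of_size X Y k.
  apply/setDidPl; rewrite disjoint_sym; apply/pred0P => C /=; rewrite !inE.
  apply/negP=> /andP[/andP[_ /andP[/eqP h _]] /andP[_ /andP[/eqP h' _]]].
  by move: h; rewrite h' => /n_Sn.
rewrite -[in RHS]ha -[in RHS]hb -!prod_nat_const; congr (_ * _).
  apply: eq_bigr => C; rewrite inE => /andP[hC hs].
  exact: card_matchings_crown hreg hXY (component_adj_closed hC) hs.
apply: eq_bigr => C; rewrite inE => /andP[hC hs].
exact: card_matchings_complete hreg hXY (component_adj_closed hC) hs.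
Qed.

(** * Asymptotics of factorials and derangements *)

Local Open Scope classical_set_scope.
Local Open Scope ring_scope.

(** Both bounds come from [ln (1 + t) <= t], taken at [t = - (x + 1)^-1] for the lower one and at
    [t = x^-1] for the upper one. *)
Lemma mul_ln_ratio_bounds (R : realType) (x : R) : 0 < x ->
  1 - (x + 1)^-1 <= x * (ln (x + 1) - ln x) <= 1.
Proof.
move=> x0; have x1 : 0 < x + 1 by rewrite addr_gt0.
have xn0 : x != 0 by rewrite gt_eqF.
have x1n0 : x + 1 != 0 by rewrite gt_eqF.
apply/andP; split.
  have : ln (1 - (x + 1)^-1) <= - (x + 1)^-1.
    by apply: le_ln1Dx; rewrite ltrN2 invf_lt1 // ltrDr.
  have -> : 1 - (x + 1)^-1 = x / (x + 1) by field.
  rewrite ln_div ?posrE // -lerN2 opprB opprK => /(ler_wpM2l (ltW x0)).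
  by rewrite mulrC.
have : ln (1 + x^-1) <= x^-1.
  by apply: le_ln1Dx; rewrite (lt_trans (ltrN10 _)) // invr_gt0.
have -> : 1 + x^-1 = (x + 1) / x by field.
by rewrite ln_div ?posrE // => /(ler_wpM2l (ltW x0)); rewrite mulfV.
Qed.

Lemma cvg_mul_ln_succ (R : realType) :
  (fun j : nat => j.+1%:R * (ln j.+2%:R - ln j.+1%:R) : R) @ \oo --> (1 : R).
Proof.
apply: (@squeeze_cvgr _ _ _ _ (fun j => 1 - j.+2%:R^-1) (fun=> 1)).
- near=> j; have := @mul_ln_ratio_bounds R j.+1%:R; rewrite natr1.
  by apply; rewrite ltr0n.
- rewrite -[X in _ --> X]subr0; apply: cvgB; first exact: cvg_cst.
  have := @cvg_harmonic R; rewrite -cvg_shiftS; exact.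
- exact: cvg_cst.
Unshelve. all: by end_near. Qed.

Lemma cvg_ln_fact_mean (R : realType) :
  (fun k : nat => ln k.+1%:R - ln k`!%:R / k%:R : R) @ \oo --> (1 : R).
Proof.
(* The shift matches the Cesaro mean, whose term of index [k] averages the first [k.+1] values. *)
rewrite -cvg_shiftS /=.
have := cesaro (@cvg_mul_ln_succ R); apply: cvg_trans; apply: near_eq_cvg.
near=> k.
(* Summation by parts: the weights [j.+1] leave one boundary term and the sum of logarithms that
   makes up [ln m!]. *)
have telescoped (m : nat) :
    series (fun j : nat => j.+1%:R * (ln j.+2%:R - ln j.+1%:R) : R) m =
    m%:R * ln m.+1%:R - ln m`!%:R.
  elim: m => [|m IH].
    by rewrite /series /= big_geq // mul0r fact0 ln1 subr0.
  rewrite seriesSr IH factS natrM lnM ?posrE ?ltr0n ?fact_gt0 //.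
  rewrite -[m.+1%:R]natr1; ring.
rewrite -[LHS]/(k.+1%:R^-1 * series _ k.+1) telescoped mulrBr mulKf ?pnatr_eq0 //.
by rewrite [in RHS]mulrC.
Unshelve. all: by end_near. Qed.

Lemma cvg_root_fact (R : realType) :
  (fun k : nat => k.+1%:R / k`!%:R `^ (k%:R^-1) : R) @ \oo --> expR (1 : R).
Proof.
have : expR (ln k.+1%:R - ln k`!%:R / k%:R) @[k --> \oo] --> expR (1 : R).
  by apply: continuous_cvg; [exact: continuous_expR|exact: cvg_ln_fact_mean].
apply: cvg_trans; apply: near_eq_cvg.
near=> k; rewrite /= expRB lnK ?posrE ?ltr0n //.
(* [powR] treats a zero base separately; a factorial is positive, so the exponential branch
   applies. *)
by rewrite /powR pnatr_eq0 -[_ == 0%N]negbK -lt0n fact_gt0 [_ / k%:R]mulrC.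
Unshelve. all: by end_near. Qed.

(** Partial sums of the exponential series at -1, read two places further: the formula for
    derangements of [k.+1] points has [k.+2] terms. *)
Lemma cvg_derangement_density (R : realType) :
  (fun k : nat => \sum_(j < k.+2) (-1) ^+ j / j`!%:R : R) @ \oo
    --> expR (-1 : R).
Proof.
have h : series (exp_coeff (-1 : R)) @ \oo --> expR (-1 : R).
  exact: is_cvg_series_exp_coeff.
have := h; rewrite -(cvg_shiftn 2).
apply: cvg_trans; apply: near_eq_cvg; near=> k.
by rewrite /= addn2 /series /= big_mkord.
Unshelve. all: by end_near. Qed.

Lemma cvg_derangement_ratio (R : realType) :
  (fun k : nat => #|[set s : {perm 'I_k.+1} | [forall i, s i != i]]%SET|%:R /
     (k`!%:R * k`!%:R `^ (k%:R^-1)) : R) @ \oo --> (1 : R).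
Proof.
have : (\sum_(j < k.+2) (-1) ^+ j / j`!%:R) * (k.+1%:R / k`!%:R `^ k%:R^-1)
    @[k --> \oo] --> (1 : R).
  have e1 : expR (-1) * expR 1 = 1 :> R by rewrite mulrC expRxMexpNx_1.
  rewrite -[X in _ --> X]e1.
  by apply: cvgM; [exact: cvg_derangement_density|exact: cvg_root_fact].
apply: cvg_trans; apply: near_eq_cvg.
(* Writing [k.+1! = k.+1 * k!] cancels one [k!] and leaves the product of the two limits [expR (-1)]
   and [expR 1]. *)
near=> k; rewrite card_derangements card_ord factS natrM /=.
have h1 : k`!%:R != 0 :> R by rewrite pnatr_eq0 -lt0n fact_gt0.
have h2 : k`!%:R `^ k%:R^-1 != 0 :> R.
  by rewrite gt_eqF // powR_gt0 ltr0n fact_gt0.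
by field; rewrite h1 h2.
Unshelve. all: by end_near. Qed.

(** * The limit of the normalised number of matchings *)

(** Here [b] is fixed while [a], [n] and the graph vary with [k]. The conditions are imposed for
    [k > b], hence for all large [k], and [hab] makes the truncated [a k - b] the true
    difference. *)
Theorem theorem3 (R : realType) (b : nat) (a n : nat -> nat)
    (H : nat -> sgraph) (X Y : forall k : nat, {set H k})
    (hab : forall k : nat, (b < k)%N -> (b <= a k)%N)
    (hn : forall k : nat, (b < k)%N -> n k = (a k * k + b)%N)
    (hreg : forall k : nat, (b < k)%N -> regular (H k) k)
    (hbip : forall k : nat, (b < k)%N -> bipartition (X k) (Y k))
    (hX : forall k : nat, (b < k)%N -> #|X k| = n k)
    (hY : forall k : nat, (b < k)%N -> #|Y k| = n k)
    (hcomp : forall k : nat, (b < k)%N ->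
       [/\ components (H k) =
             components_of_size (X k) (Y k) k.+1 :|:
             components_of_size (X k) (Y k) k,
           #|components_of_size (X k) (Y k) k.+1| = b
         & #|components_of_size (X k) (Y k) k| = (a k - b)%N]) :
  (fun k : nat => (num_perfect_matchings (H k) (n k))%:R /
     ((k`!)%:R `^ ((n k)%:R / k%:R)) : R) @ \oo --> (1 : R).
Proof.
pose u (k : nat) : R :=
  #|[set s : {perm 'I_k.+1} | [forall i, s i != i]]%SET|%:R /
     (k`!%:R * k`!%:R `^ (k%:R^-1)).
have : u k ^+ b @[k --> \oo] --> (1 : R).
  rewrite -[X in _ --> X](expr1n _ b).
  (* The exponent [b] does not depend on [k], so continuity of the power map at 1 suffices. *)
  exact: (cvg_comp u _ (@cvg_derangement_ratio R) (@exprn_continuous R b 1)).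
apply: cvg_trans; apply: near_eq_cvg; near=> k.
have bk : (b < k)%N by near: k; exact: nbhs_infty_gt.
have [hc hb ha] := hcomp k bk.
rewrite -hX //.
rewrite (card_perfect_matchings_components (hreg k bk) (hbip k bk) hc hb ha).
(* The exponent [n k / k] becomes [a k + b / k]; here [k] is nonzero because it exceeds [b]. *)
rewrite hX // hn // natrM !natrX natrD natrM mulrDl mulfK; last first.
  by rewrite pnatr_eq0 -lt0n (leq_ltn_trans _ bk).
have f0 : (0 : R) < k`!%:R by rewrite ltr0n fact_gt0.
rewrite powRD ?(gt_eqF f0) ?implybT //.
rewrite powR_mulrn ?ltW // [b%:R / _]mulrC powRrM powR_mulrn ?powR_ge0 //.
(* The factor with exponent [a k - b] cancels the components of size [k]; the other gives one [k!]
   to each of the [b] larger components. *)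
have -> : k`!%:R ^+ a k = k`!%:R ^+ (a k - b) * k`!%:R ^+ b :> R.
  by rewrite -exprD subnK // hab.
rewrite /u expr_div_n exprMn.
have h1 i : k`!%:R ^+ i != 0 :> R by rewrite expf_neq0 // gt_eqF.
have h2 : (k`!%:R `^ k%:R^-1) ^+ b != 0 :> R.
  by rewrite expf_neq0 // gt_eqF // powR_gt0.
by field; rewrite !h1 h2.
Unshelve. all: by end_near. Qed.
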